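(* Let $x(t)=x^{(N)}(t)$ be the Markov process with generator $L=L_0+L_s$ defined in the context, and let $R_N(t):=\mathsf E\,V(x(t))$. Assume $\sup_N |R_N(0)|<\infty$, and let $t(N)\to\infty$ as $N\to\infty$. Put $\varkappa=\sum_{j=1}^l k_j^2-k$. Then, as $N\to\infty$ (with $f\sim g$ meaning $f/g\to1$): (i) if $t(N)/N^2\to0$, then $R_N(t(N))\sim\alpha b_2\,t(N)$; (ii) if $t(N)=cN^2$ for a constant $c>0$, then $R_N(t(N))\sim\alpha b_2(\delta\varkappa)^{-1}\big(1-e^{-\delta\varkappa c}\big)N^2$; (iii) if $t(N)/N^2\to\infty$, then $R_N(t(N))\sim\alpha b_2(\delta\varkappa)^{-1}N^2$.
   Context: Fix an integer $k\ge2$ and integers $k_1,\dots,k_l\ge2$ with $k_1+\dots+k_l=k$ (fixed independently of $N$). For $N\ge k$, let $\mathcal I$ be the set of ordered $k$-tuples $(i_1,\dots,i_k)$ of pairwise distinct elements of $\{1,\dots,N\}$. For $(i_1,\dots,i_k)\in\mathcal I$ split it into consecutive blocks $\Gamma_1,\dots,\Gamma_l$ of lengths $k_1,\dots,k_l$ and let $g_j$ be the first element of $\Gamma_j$. The synchronization map $J^{(i_1,\dots,i_k)}:\mathbb{R}^N\to\mathbb{R}^N$, $x\mapsto y$, is $y_m=x_m$ if $m\notin\{i_1,\dots,i_k\}$ and $y_m=x_{g_j}$ if $m\in\Gamma_j$. Let $\alpha>0,\delta>0$ (independent of $N$), and let $\rho$ be a probability measure on $\mathbb{R}$ with compact support and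 $b_2:=\int z^2\rho(dz)>0$. The process $x(t)=(x_1(t),\dots,x_N(t))\in\mathbb{R}^N$ is the continuous-time Markov jump process with generator $L=L_0+L_s$, $(L_0f)(x)=\alpha\sum_{i=1}^N\int\big(f(x+ze_i)-f(x)\big)\rho(dz)$, $(L_sf)(x)=\frac{\delta}{N(N-1)\cdots(N-k+1)}\sum_{(i_1,\dots,i_k)\in\mathcal I}\big(f(J^{(i_1,\dots,i_k)}x)-f(x)\big)$: each particle independently jumps $x_i\to x_i+z$, $z\sim\rho$, at rate $\alpha$, and independently at rate $\delta$ a uniformly random tuple of $\mathcal I$ is chosen and the configuration is replaced by $J^{(i_1,\dots,i_k)}x$. The initial configuration $x(0)$ may be random. $V(x)=\frac{1}{N(N-1)}\sum_{1\le m<n\le N}(x_m-x_n)^2$ (the empirical variance). *)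

(* Defs.v *)
From HB Require Import structures.
From mathcomp Require Import all_boot all_order all_algebra.
From mathcomp Require Import all_classical all_reals all_analysis.
Set Implicit Arguments. Unset Strict Implicit. Unset Printing Implicit Defensive.
Import Order.TTheory GRing.Theory Num.Theory.
Import numFieldNormedType.Exports.
Local Open Scope classical_set_scope.
Local Open Scope ring_scope.
Local Open Scope ereal_scope.

Definition shift (R : realType) (N : nat) (x : 'I_N -> R) (i : 'I_N) (z : R)
  : 'I_N -> R := fun m => if m == i then (x m + z)%R else x m.

(* for block lengths ks = [:: k_1; ...; k_l], position p (0-based) in
   {0,..,k-1}: the position of the first element of the block containing p *)
Fixpoint blockstart (ks : seq nat) (p : nat) : nat :=
  match ks with
  | [::] => p
  | a :: ks' => if (p < a)%N then 0%N else (a + blockstart ks' (p - a))%N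
  end.

Definition sync (R : realType) (N k : nat) (ks : seq nat)
  (u : {ffun 'I_k -> 'I_N}) (x : 'I_N -> R) : 'I_N -> R :=
  fun m => match [pick p : 'I_k | u p == m] with
           | Some p => x (nth m (map u (enum 'I_k)) (blockstart ks p))
           | None => x m
           end.

Definition jrate (R : realType) (alpha delta : R) (N : nat) : R :=
  (alpha * N%:R + delta)%R.

(* Markov kernel K = I + L / lambda of the embedded (uniformized) jump chain,
   acting on nonnegative functions *)
Definition jump_kernel (R : realType) (rho : probability R R) (alpha delta : R)
  (k : nat) (ks : seq nat) (N : nat) (f : ('I_N -> R) -> \bar R)
  : ('I_N -> R) -> \bar R :=
  fun x =>
    ((alpha / jrate alpha delta N)%R)%:E *
      (\sum_(i < N) \int[rho]_z f (shift x i z))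
  + ((delta / jrate alpha delta N / (N ^_ k)%:R)%R)%:E *
      (\sum_(u : {ffun 'I_k -> 'I_N} | injectiveb u) f (sync ks u x)).

(* Transition semigroup P_t f (x) = E_x f(x(t)) = sum_n Poisson(lambda t)(n) K^n f (x) *)
Definition semigroup (R : realType) (rho : probability R R) (alpha delta : R)
  (k : nat) (ks : seq nat) (N : nat) (t : R) (f : ('I_N -> R) -> \bar R)
  (x : 'I_N -> R) : \bar R :=
  \sum_(0 <= n <oo)
    ((expR (- (jrate alpha delta N * t)) * (jrate alpha delta N * t) ^+ n
       / (n`!)%:R)%R)%:E * iter n (@jump_kernel R rho alpha delta k ks N) f x.

Definition emp_var (R : realType) (N : nat) (x : 'I_N -> R) : R :=
  ((\sum_(m < N) \sum_(n < N | (m < n)%N) (x m - x n) ^+ 2)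
     / (N * (N - 1))%:R)%R.

(* R_N(t) = E V(x(t)), where x(0) = (X N i)_i on the probability space (Omega, P) *)
Definition RN (R : realType) (rho : probability R R) (alpha delta : R)
  (k : nat) (ks : seq nat) (d : measure_display) (Omega : measurableType d)
  (P : probability Omega R) (X : forall N : nat, 'I_N -> Omega -> R)
  (N : nat) (t : R) : \bar R :=
  \int[P]_w @semigroup R rho alpha delta k ks N t (fun x => (emp_var x)%:E)
                      (fun i => X N i w).

Definition moment2 (R : realType) (rho : probability R R) : R :=
  fine (\int[rho]_z ((z ^+ 2)%:E)).

(* Main.v *)
(** The empirical variance V satisfies L V = alpha b_2 - theta V with
    theta = delta kappa / (N (N - 1)): in L_0 V the terms linear in the jump
    cancel, and averaging a synchronization over all relabellings of the
    particles multiplies V by the proportion of ordered pairs of distinct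
    particles that keep distinct sources.  So R_N solves a linear ODE,
    R_N(t) = e^(-theta t) R_N(0) + alpha b_2 (1 - e^(-theta t)) / theta,
    and the three regimes are theta t -> 0, theta t -> delta kappa c and
    theta t -> +oo.  For the semigroup, a Poisson mixture of powers of the
    jump kernel K, the ODE is replaced by the recurrence
    K V = (1 - theta / lambda) V + alpha b_2 / lambda. *)
Require Import Defs.
From HB Require Import structures.
From mathcomp Require Import all_boot all_order all_algebra all_fingroup.
From mathcomp Require Import all_classical all_reals all_analysis.
From mathcomp Require Import measurable_realfun zify ring lra.
Import Order.TTheory GRing.Theory Num.Theory.
Import numFieldNormedType.Exports.
Local Open Scope classical_set_scope.
Local Open Scope ring_scope.

(** * Pairs of particles under a synchronization *)

Lemma blockstart_le (ks : seq nat) (p : nat) : (blockstart ks p <= p)%N.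
Proof.
elim: ks p => [|a ks IH] p //=.
by case: ltnP => // ap; rewrite -[leqRHS](subnKC ap) leq_add2l.
Qed.

Definition blockstart_ord (k : nat) (ks : seq nat) (p : 'I_k) : 'I_k :=
  Ordinal (leq_ltn_trans (blockstart_le ks p) (ltn_ord p)).

(** Induction on the blocks. Positions in the first block have start 0, later ones have start at
    least [a], which is nonzero, so the mixed pairs contribute nothing and the first block adds
    [a ^ 2]. *)
Lemma sum_eq_blockstart (ks : seq nat) : all (fun a => 2 <= a)%N ks ->
  (\sum_(p < sumn ks) \sum_(q < sumn ks) (blockstart ks p == blockstart ks q)
   = sumn (map (fun a => a ^ 2) ks))%N.
Proof.
elim: ks => [|a ks IH] /=; first by rewrite big_ord0.
case/andP=> a2 /IH {}IH; have a0 : (a == 0)%N = false by case: a a2.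
rewrite big_split_ord /= -IH; congr (_ + _)%N.
- transitivity (\sum_(i < a) a)%N; last by rewrite sum_nat_const card_ord mulnn.
  apply: eq_bigr => i _; rewrite ltn_ord big_split_ord /=.
  rewrite [X in (_ + X)%N]big1 ?addn0; last first.
    by move=> j _; rewrite ltnNge leq_addr /= eq_sym addn_eq0 a0.
  transitivity (\sum_(i < a) 1)%N; last by rewrite sum1_card card_ord.
  by apply: eq_bigr => j _; rewrite ltn_ord.
- apply: eq_bigr => i _; rewrite ltnNge leq_addr /= addKn big_split_ord /=.
  rewrite big1 ?add0n; last first.
    by move=> j _; rewrite ltn_ord addn_eq0 a0.
  by apply: eq_bigr => j _; rewrite ltnNge leq_addr /= addKn eqn_add2l.
Qed.

(** This gives kappa > 0: the first block satisfies a < a^2 because a >= 2, and every other block at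
    least a <= a^2. *)
Lemma sumn_lt_sumn_sqr (ks : seq nat) : all (fun a => 2 <= a)%N ks ->
  (0 < sumn ks -> sumn ks < sumn (map (fun a => a ^ 2) ks))%N.
Proof.
have le s : (sumn s <= sumn (map (fun a => a ^ 2) s))%N.
  by elim: s => //= a s IH; rewrite leq_add //; case: a => // a; rewrite -mulnn leq_pmull.
case: ks => //= a ks /andP[a2 _] _.
by rewrite -addSn leq_add // -mulnn ltn_Pmull // ltnW.
Qed.

(** The index from which particle [m] copies its value. It separates the combinatorics of a
    synchronization from the configuration it acts on. *)
Definition source (N k : nat) (ks : seq nat) (u : {ffun 'I_k -> 'I_N})
  (m : 'I_N) : 'I_N :=
  if [pick p : 'I_k | u p == m] is Some p
  then nth m (map u (enum 'I_k)) (blockstart ks p) else m.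

Lemma syncE (R : realType) (N k : nat) (ks : seq nat)
  (u : {ffun 'I_k -> 'I_N}) (x : 'I_N -> R) (m : 'I_N) :
  sync ks u x m = x (source N k ks u m).
Proof. by rewrite /sync /source; case: pickP. Qed.

Lemma source_im (N k : nat) (ks : seq nat) (u : {ffun 'I_k -> 'I_N}) (p : 'I_k) :
  injective u -> source N k ks u (u p) = u (blockstart_ord k ks p).
Proof.
move=> ui; rewrite /source; case: pickP => [q /eqP/ui ->|/(_ p)]; last by rewrite eqxx.
(* A block starts inside the tuple, so the default value of [nth] is never returned. *)
have bk : (blockstart ks p < k)%N by exact: ltn_ord (blockstart_ord k ks p).
rewrite (nth_map p) ?size_enum_ord //; congr (u _); apply/val_inj => /=.
by rewrite nth_enum_ord.
Qed.

Lemma source_notin (N k : nat) (ks : seq nat) (u : {ffun 'I_k -> 'I_N})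
  (m : 'I_N) : m \notin codom u -> source N k ks u m = m.
Proof.
move=> mu; rewrite /source; case: pickP => // p /eqP e.
by rewrite -e codom_f in mu.
Qed.

(** Block starts depend on positions in the tuple and not on the labels stored there, so relabelling
    the tuple by [s] conjugates the source map by [s]. *)
Lemma source_perm (N k : nat) (ks : seq nat) (u : {ffun 'I_k -> 'I_N})
  (s : 'S_N) (m : 'I_N) : injective u ->
  source N k ks [ffun p => s (u p)] (s m) = s (source N k ks u m).
Proof.
move=> ui; have vi : injective [ffun p => s (u p)].
  by move=> p q; rewrite !ffunE => /perm_inj/ui.
have [/codomP[p ->]|mu] := boolP (m \in codom u).
  have -> : s (u p) = [ffun p => s (u p)] p by rewrite ffunE.
  by rewrite !source_im // ffunE.
rewrite !source_notin //; apply: contra mu => /codomP[p].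
by rewrite ffunE => /perm_inj ->; exact: codom_f.
Qed.

Lemma sum_codom (N k : nat) (u : {ffun 'I_k -> 'I_N}) (F : 'I_N -> nat) :
  injective u -> (\sum_(m in codom u) F m = \sum_p F (u p))%N.
Proof.
move=> ui; rewrite -big_uniq /=; last exact/injectiveP.
by rewrite /codom /image_mem big_map big_enum.
Qed.

(** A particle outside the tuple is the source of itself only, which gives N - k pairs; inside the
    tuple, equal sources mean equal block starts. Adding [k] on the left avoids truncated
    subtraction. *)
Lemma sum_eq_source (N k : nat) (ks : seq nat) (u : {ffun 'I_k -> 'I_N}) :
  injective u ->
  (\sum_m \sum_n (source N k ks u m == source N k ks u n) + k =
   N + \sum_(p < k) \sum_(q < k) (blockstart ks p == blockstart ks q))%N.
Proof.
move=> ui.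
have cu : (#|codom u| = k)%N by rewrite card_codom // card_ord.
rewrite (bigID (mem (codom u))) /= sum_codom // -addnA addnC; congr (_ + _)%N.
  rewrite -[in RHS](card_ord N) -(cardC (mem (codom u))) cu addnC; congr (_ + _)%N.
  rewrite -sum1_card; apply: eq_bigr => m mu.
  rewrite (bigD1 m) //= eqxx big1 // => n nm.
  rewrite source_notin //; apply/eqP; rewrite eqb0; apply/eqP => mn.
  have [/codomP[p e]|nu] := boolP (n \in codom u).
    by move: mu; rewrite mn e source_im // codom_f.
  by move: nm; rewrite mn source_notin // eqxx.
apply: eq_bigr => p _.
rewrite (bigID (mem (codom u))) /= sum_codom // [X in (_ + X)%N]big1 ?addn0.
  by apply: eq_bigr => q _; rewrite !source_im // (inj_eq ui).
move=> n nu; apply/eqP; rewrite eqb0 source_im // source_notin //.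
by apply: contra nu => /eqP <-; exact: codom_f.
Qed.

Lemma perm_two_transitive (T : finType) (a b c d : T) : a != b -> c != d ->
  exists s : {perm T}, s a = c /\ s b = d.
Proof.
(* The left factor acts first and sends [a] to [c]; the second transposition moves the image of [b]
   to [d] and fixes [c]. *)
move=> ab cd; exists (tperm a c * tperm (tperm a c b) d)%g.
rewrite !permM tpermL; split; last by rewrite tpermL.
rewrite tpermD //; last by rewrite eq_sym.
by rewrite -{2}(tpermL a c) (inj_eq perm_inj) eq_sym.
Qed.

Lemma sum_perm_pair (R : realType) (T : finType) (g : T -> T -> R) (a b c d : T) :
  a != b -> c != d ->
  \sum_(s : {perm T}) g (s a) (s b) = \sum_(s : {perm T}) g (s c) (s d).
Proof.
move=> ab cd; have [r [<- <-]] := perm_two_transitive T _ _ _ _ ab cd.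
rewrite (reindex_inj (mulgI r)) /=.
by apply: eq_bigr => s _; rewrite !permM.
Qed.

(** All ordered pairs are summed, because the restriction m < n would not survive a permutation of
    the particles. *)
Definition pair_sum (R : realType) (N : nat) (x : 'I_N -> R) : R :=
  \sum_m \sum_n (x m - x n) ^+ 2.

Lemma sum_injective_perm (R : realType) (N k : nat) (s : 'S_N)
    (F : {ffun 'I_k -> 'I_N} -> R) :
  \sum_(u : {ffun 'I_k -> 'I_N} | injectiveb u) F u =
  \sum_(u : {ffun 'I_k -> 'I_N} | injectiveb u) F [ffun p => s (u p)].
Proof.
rewrite (reindex (fun u : {ffun 'I_k -> 'I_N} => [ffun p => s (u p)])) /=.
  apply: eq_bigl => u; apply/injectiveP/injectiveP => ui p q.
    by move=> e; apply: ui; rewrite !ffunE e.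
  by rewrite !ffunE => /perm_inj/ui.
exists (fun u : {ffun 'I_k -> 'I_N} => [ffun p => (s^-1)%g (u p)]) => u _;
  by apply/ffunP => p; rewrite !ffunE ?permK ?permKV.
Qed.

(* Averaging over all relabellings s of the particles: for a != b the sum
   over s of (x_(s a) - x_(s b))^2 does not depend on (a, b), so both sides
   reduce to counting pairs with distinct sources. *)
Lemma sum_pair_sum_sync (R : realType) (N k : nat) (ks : seq nat)
    (x : 'I_N -> R) :
  (2 <= N)%N -> all (fun a => 2 <= a)%N ks -> sumn ks = k ->
  (N * (N - 1))%:R *
    (\sum_(u : {ffun 'I_k -> 'I_N} | injectiveb u) pair_sum R N (sync ks u x)) =
  (N ^_ k)%:R * ((N * (N - 1))%:R -
     ((sumn (map (fun a => (a ^ 2)%N) ks))%:R - k%:R)) * pair_sum R N x.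
Proof.
move=> N2 ks2 ksk; set K2 := sumn (map _ _).
have bsK := sum_eq_blockstart _ ks2; rewrite ksk in bsK.
pose g (a b : 'I_N) : R := (x a - x b) ^+ 2.
pose G a b := \sum_(s : 'S_N) g (s a) (s b).
pose o0 : 'I_N := Ordinal (ltnW N2). pose o1 : 'I_N := Ordinal N2.
(* One formula covers both cases, so that sums of [G] become counts of coinciding indices. *)
have GE a b : G a b = G o0 o1 * (1 - (a == b)%:R).
  have [->|ab] := eqVneq a b.
    by rewrite subrr mulr0 /G big1 // => s _; rewrite /g subrr expr0n.
  by rewrite subr0 mulr1; exact: sum_perm_pair.
have GsumE (f : 'I_N -> 'I_N) : \sum_m \sum_n G (f m) (f n) =
    G o0 o1 * ((N * N)%:R - (\sum_m \sum_n (f m == f n))%:R).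
  transitivity (\sum_m \sum_n (G o0 o1 * (1 - (f m == f n)%:R))).
    by apply: eq_bigr => m _; apply: eq_bigr => n _; exact: GE.
  transitivity (\sum_m G o0 o1 * (\sum_(n < N) 1 - \sum_n (f m == f n)%:R)).
    by apply: eq_bigr => m _; rewrite -mulr_sumr sumrB.
  rewrite -mulr_sumr sumrB; congr (_ * (_ - _)).
    by rewrite !sumr_const !card_ord -mulrnA.
  by rewrite natr_sum; under [RHS]eq_bigr do rewrite natr_sum.
have D0 : #|'S_N|%:R * pair_sum R N x = G o0 o1 * (N * (N - 1))%:R.
  transitivity (\sum_m \sum_n G m n).
    transitivity (\sum_(s : 'S_N) \sum_m \sum_n g (s m) (s n)).
      rewrite -sum1_card natr_sum mulr_suml; apply: eq_bigr => s _.
      rewrite mul1r /pair_sum (reindex_inj (@perm_inj _ s)).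
      by apply: eq_bigr => m _; rewrite (reindex_inj (@perm_inj _ s)).
    by rewrite exchange_big; apply: eq_bigr => m _; rewrite exchange_big.
  rewrite (GsumE id); congr (_ * _).
  have -> : (\sum_(m < N) \sum_(n < N) (m == n) = N)%N.
    transitivity (\sum_(m < N) 1)%N; last by rewrite sum1_card card_ord.
    apply: eq_bigr => m _; rewrite (bigD1 m) //= eqxx big1 // => n.
    by rewrite eq_sym => /negbTE ->.
  by rewrite mulnBr muln1 natrB // leq_pmulr // ltnW.
have D1 : #|'S_N|%:R *
    (\sum_(u : {ffun 'I_k -> 'I_N} | injectiveb u) pair_sum R N (sync ks u x)) =
    (N ^_ k)%:R * (G o0 o1 * ((N * (N - 1))%:R - (K2%:R - k%:R))).
  transitivity (\sum_(u : {ffun 'I_k -> 'I_N} | injectiveb u)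
      \sum_m \sum_n G (source N k ks u m) (source N k ks u n)).
    transitivity (\sum_(s : 'S_N) \sum_(u : {ffun 'I_k -> 'I_N} | injectiveb u)
       \sum_m \sum_n g (s (source N k ks u m)) (s (source N k ks u n))).
      rewrite -sum1_card natr_sum mulr_suml; apply: eq_bigr => s _.
      rewrite mul1r (sum_injective_perm _ _ _ s); apply: eq_bigr => u /injectiveP ui.
      rewrite /pair_sum (reindex_inj (@perm_inj _ s)); apply: eq_bigr => m _.
      rewrite (reindex_inj (@perm_inj _ s)); apply: eq_bigr => n _.
      by rewrite !syncE !source_perm.
    rewrite exchange_big; apply: eq_bigr => u _.
    by rewrite exchange_big; apply: eq_bigr => m _; rewrite exchange_big.
  have cI : #|[pred u : {ffun 'I_k -> 'I_N} | injectiveb u]| = (N ^_ k)%N.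
    by rewrite -(cardsE [pred u : {ffun 'I_k -> 'I_N} | injectiveb u])
       card_inj_ffuns !card_ord.
  rewrite -cI -sum1_card natr_sum mulr_suml; apply: eq_bigr => u /injectiveP ui.
  rewrite mul1r GsumE; congr (_ * _).
  (* The coinciding pairs number N + K2 - k, and N^2 - (N + K2 - k) = N (N - 1) - (K2 - k). *)
  have := sum_eq_source _ _ ks _ ui.
  rewrite bsK => /(congr1 (fun n => n%:R : R)).
  rewrite !natrD mulnBr muln1 natrB ?leq_pmulr 1?ltnW // -/K2 => e.
  lra.
have S0 : #|'S_N|%:R != 0 :> R.
  by rewrite pnatr_eq0 -lt0n; apply/card_gt0P; exists 1%g.
apply: (mulfI S0); rewrite mulrCA D1 mulrA [RHS]mulrCA D0; ring.
Qed.

(** * Empirical variance under a synchronization and under a single jump *)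

Lemma pair_sumE (R : realType) (N : nat) (x : 'I_N -> R) :
  pair_sum R N x =
  2 * (N%:R * (\sum_i x i ^+ 2) - (\sum_i x i) ^+ 2).
Proof.
rewrite /pair_sum.
transitivity (\sum_(m < N) (N%:R * x m ^+ 2 - x m * (\sum_i x i) *+ 2
   + \sum_i x i ^+ 2)).
  apply: eq_bigr => m _; under eq_bigr do rewrite sqrrB.
  rewrite big_split /= sumrB sumr_const card_ord mulr_natl; congr (_ - _ + _).
  by rewrite sumrMnl -mulr_sumr.
rewrite big_split sumrB /= -mulr_sumr sumr_const card_ord sumrMnl -mulr_suml.
by rewrite -mulr_natl; ring.
Qed.

Lemma emp_varE (R : realType) (N : nat) (x : 'I_N -> R) :
  emp_var x = pair_sum R N x / 2 / (N * (N - 1))%:R.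
Proof.
rewrite /emp_var; congr (_ / _).
set A := \sum_m _.
have -> : pair_sum R N x = A + A.
  have -> : A + A = A + \sum_(m < N) \sum_(n < N | (n < m)%N) (x m - x n) ^+ 2.
    congr (_ + _); rewrite /A (exchange_big_dep xpredT) //=.
    by apply: eq_bigr => m _; apply: eq_bigr => n _; rewrite -sqrrN opprB.
  rewrite -big_split /=; apply: eq_bigr => m _.
  rewrite (bigID (fun n : 'I_N => (m < n)%N)) /=; congr (_ + _).
  rewrite (bigD1 m) ?ltnn //= subrr expr0n add0r; apply: eq_bigl => n.
  by rewrite -leqNgt andbC [RHS]ltn_neqAle.
by field.
Qed.

Lemma sum_emp_var_sync (R : realType) (N k : nat) (ks : seq nat)
    (x : 'I_N -> R) :
  (2 <= N)%N -> all (fun a => 2 <= a)%N ks -> sumn ks = k ->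
  \sum_(u : {ffun 'I_k -> 'I_N} | injectiveb u) emp_var (sync ks u x) =
  (N ^_ k)%:R * (1 - ((sumn (map (fun a => (a ^ 2)%N) ks))%:R - k%:R)
                     / (N * (N - 1))%:R) * emp_var x.
Proof.
move=> N2 ks2 ksk; have := sum_pair_sum_sync R N k ks x N2 ks2 ksk => e.
have N0 : (N * (N - 1))%:R != 0 :> R by rewrite pnatr_eq0; lia.
under eq_bigr do rewrite emp_varE.
rewrite emp_varE -!mulr_suml; apply: (mulfI N0); rewrite 2!mulrA e; field.
by rewrite andbC -negb_or -mulf_eq0 -natrM.
Qed.

(** A jump changes only the first two power sums. The coefficient of z sums to zero over i; that of
    z^2 equals 1/N for N >= 2, so the N particles together contribute z^2. *)
Lemma emp_var_shift (R : realType) (N : nat) (x : 'I_N -> R) (i : 'I_N) (z : R) :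
  emp_var (Defs.shift x i z) = emp_var x
    + (2 * (N%:R * x i - \sum_j x j) / (N * (N - 1))%:R) * z
    + ((N%:R - 1) / (N * (N - 1))%:R) * z ^+ 2.
Proof.
rewrite !emp_varE !pair_sumE.
have -> : \sum_j Defs.shift x i z j = \sum_j x j + z.
  rewrite (bigD1 i) //= [in RHS](bigD1 i) //= /Defs.shift eqxx addrAC.
  by congr (_ + _ + _); apply: eq_bigr => j /negbTE ->.
have -> : \sum_j Defs.shift x i z j ^+ 2 = \sum_j x j ^+ 2 + (2 * x i * z + z ^+ 2).
  rewrite (bigD1 i) //= [in RHS](bigD1 i) //= {1}/Defs.shift eqxx.
  rewrite (eq_bigr (fun j => x j ^+ 2)); first by ring.
  by move=> j /negbTE e; rewrite /Defs.shift e.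
(* Treating the inverse as an opaque factor keeps the identity valid at N = 1, where the denominator
   is zero. *)
by move: ((N * (N - 1))%:R^-1 : R) => p; field.
Qed.

(** * The jump kernel and the semigroup on the empirical variance *)

(** Since [fine] sends infinite values to 0, a positive [moment2] forces the integral of z^2 to be
    finite. *)
Lemma integrable_sqr (R : realType) (rho : probability R R) :
  0 < moment2 rho -> rho.-integrable setT (fun z : R => (z ^+ 2)%:E).
Proof.
move=> m0; apply/integrableP; split.
  by apply/(measurable_EFinP _ (fun z : R => z ^+ 2)).
rewrite integral_fin_num_abs //.
by move: m0; rewrite /moment2; case: integral => //=; rewrite ltxx.
Qed.

Lemma integrable_id (R : realType) (rho : probability R R) :
  0 < moment2 rho -> rho.-integrable setT (fun z : R => z%:E).
Proof.
move=> /integrable_sqr iz.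
have ig : rho.-integrable setT (fun z : R => (1 + z ^+ 2)%:E).
  rewrite (_ : (fun z : R => _) = ((EFin \o cst 1%R) \+ (fun z : R => (z ^+ 2)%:E))%E) //.
  by apply: integrableD => //; exact: finite_measure_integrable_cst.
apply: (le_integrable measurableT _ _ ig).
  by apply/(measurable_EFinP _ (fun z : R => z)).
move=> z _ /=; rewrite lee_fin [leRHS]ger0_norm; last by rewrite addr_ge0 ?sqr_ge0.
rewrite -real_normK ?num_real //.
have := sqr_ge0 (`|z| - 1); have := normr_ge0 z; nra.
Qed.

Lemma integral_quadratic (R : realType) (rho : probability R R) (a b c : R) :
  0 < moment2 rho ->
  (\int[rho]_z (a + b * z + c * z ^+ 2)%:E =
   (a + b * fine (\int[rho]_z z%:E) + c * moment2 rho)%:E)%E.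
Proof.
move=> m0; have iz := integrable_id _ _ m0; have iz2 := integrable_sqr _ _ m0.
have ic : rho.-integrable setT (EFin \o cst a) by exact: finite_measure_integrable_cst.
rewrite (_ : (fun z : R => _) = (((EFin \o cst a) \+ (fun z : R => b%:E * z%:E))
   \+ (fun z : R => c%:E * (z ^+ 2)%:E))%E); last by apply/funext.
rewrite integralD //=; last 2 first.
- by apply: integrableD => //; exact: integrableZl.
- exact: integrableZl.
rewrite integralD //=; last exact: integrableZl.
rewrite !integralZl // integral_cst //= probability_setT mule1.
by rewrite !EFinD !EFinM /moment2 !fineK //; exact: integrable_fin_num.
Qed.

(* The relaxation rate of E V(x(t)): L V = alpha b_2 - theta V. *)
Definition relax_rate (R : realType) (delta : R) (k : nat) (ks : seq nat) (N : nat) : R :=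
  delta * ((sumn (map (fun a => (a ^ 2)%N) ks))%:R - k%:R) / (N * (N - 1))%:R.

Lemma jrate_gt0 (R : realType) (alpha delta : R) (N : nat) :
  0 < alpha -> 0 < delta -> 0 < jrate alpha delta N.
Proof. by move=> a0 d0; rewrite /jrate ltr_wpDl // mulr_ge0 // ltW. Qed.

(** Affine functions of the variance form a class stable under the kernel; stating the one-step
    recurrence for all of them makes it iterable. *)
Lemma jump_kernel_emp_var (R : realType) (rho : probability R R)
    (alpha delta : R) (k : nat) (ks : seq nat) (N : nat) (a b : R) (x : 'I_N -> R) :
  (2 <= N)%N -> (k <= N)%N -> all (fun a => 2 <= a)%N ks -> sumn ks = k ->
  0 < alpha -> 0 < delta -> 0 < moment2 rho ->
  jump_kernel rho alpha delta k ks (fun y => (a * emp_var y + b)%:E) x =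
  (a * ((1 - relax_rate R delta k ks N / jrate alpha delta N) * emp_var x
        + alpha * moment2 rho / jrate alpha delta N) + b)%:E.
Proof.
move=> N2 kN ks2 ksk a0 d0 m0; rewrite /jump_kernel.
set m1 := fine (\int[rho]_z z%:E)%E.
have N0 : N%:R != 0 :> R by rewrite pnatr_eq0; lia.
have N1 : N%:R - 1 != 0 :> R by rewrite subr_eq0 (eqr_nat _ _ 1); lia.
have NN : (N * (N - 1))%:R = N%:R * (N%:R - 1) :> R.
  by rewrite natrM natrB // ltnW.
have F0 : (N ^_ k)%:R != 0 :> R by rewrite pnatr_eq0 -lt0n ffact_gt0.
have L0 := lt0r_neq0 (jrate_gt0 R alpha delta N a0 d0).
have -> : (\sum_(i < N) \int[rho]_z (a * emp_var (Defs.shift x i z) + b)%:E =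
   (\sum_(i < N) (a * (emp_var x + (2 * (N%:R * x i - \sum_j x j) / (N * (N - 1))%:R) * m1
     + ((N%:R - 1) / (N * (N - 1))%:R) * moment2 rho) + b))%:E)%E.
  rewrite -sumEFin; apply: eq_bigr => i _.
  rewrite (eq_integral (fun z : R => ((a * emp_var x + b)
    + (a * (2 * (N%:R * x i - \sum_j x j) / (N * (N - 1))%:R)) * z
    + (a * ((N%:R - 1) / (N * (N - 1))%:R)) * z ^+ 2)%:E)); last first.
    by move=> z _; rewrite emp_var_shift; congr EFin; ring.
  by rewrite integral_quadratic //; congr EFin; rewrite -/m1; ring.
rewrite sumEFin -!EFinM -EFinD; congr EFin.
have -> : \sum_(u : {ffun 'I_k -> 'I_N} | injectiveb u) (a * emp_var (sync ks u x) + b) =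
    (N ^_ k)%:R * (a * ((1 - ((sumn (map (fun a => (a ^ 2)%N) ks))%:R - k%:R)
      / (N * (N - 1))%:R) * emp_var x) + b).
  rewrite big_split /= -mulr_sumr sum_emp_var_sync // sumr_const.
  rewrite -(cardsE [pred u : {ffun 'I_k -> 'I_N} | injectiveb u]).
  by rewrite card_inj_ffuns !card_ord -mulr_natl; ring.
move: (emp_var x) => v.
(* Summing over i turns the coefficient of the mean jump [m1] into a multiple of N S - N S, where S
   is the sum of the coordinates. *)
rewrite !big_split /= -!mulr_sumr !big_split /=.
rewrite -!mulr_suml -mulr_sumr sumrB -mulr_sumr !sumr_const !card_ord.
rewrite /relax_rate !NN; rewrite /jrate in L0 *.
move: (moment2 rho) (\sum_j x j) m1 => m2 S m1.
by field; rewrite N0 N1 L0 F0.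
Qed.

Lemma relax_rate_gt0 (R : realType) (delta : R) (k : nat) (ks : seq nat) (N : nat) :
  (2 <= k)%N -> (2 <= N)%N -> all (fun a => 2 <= a)%N ks -> sumn ks = k ->
  0 < delta -> 0 < relax_rate R delta k ks N.
Proof.
move=> k2 N2 ks2 ksk d0; rewrite /relax_rate divr_gt0 ?mulr_gt0 //.
  rewrite subr_gt0 ltr_nat -{1}ksk sumn_lt_sumn_sqr // ksk; lia.
by rewrite ltr0n; lia.
Qed.

(** The value alpha b_2 / theta is the fixed point of the affine recurrence, and each step
    multiplies the deviation from it by q = 1 - theta / lambda. *)
Lemma iter_jump_kernel_emp_var (R : realType) (rho : probability R R)
    (alpha delta : R) (k : nat) (ks : seq nat) (N n : nat) (x : 'I_N -> R) :
  (2 <= k)%N -> (k <= N)%N -> all (fun a => 2 <= a)%N ks -> sumn ks = k ->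
  0 < alpha -> 0 < delta -> 0 < moment2 rho ->
  iter n (@jump_kernel R rho alpha delta k ks N) (fun y => (emp_var y)%:E) x =
  ((1 - relax_rate R delta k ks N / jrate alpha delta N) ^+ n *
    (emp_var x - alpha * moment2 rho / relax_rate R delta k ks N)
    + alpha * moment2 rho / relax_rate R delta k ks N)%:E.
Proof.
move=> k2 kN ks2 ksk a0 d0 m0.
have N2 := leq_trans k2 kN.
have T0 := lt0r_neq0 (relax_rate_gt0 R delta k ks N k2 N2 ks2 ksk d0).
have L0 := lt0r_neq0 (jrate_gt0 R alpha delta N a0 d0).
set q := 1 - _; set E := alpha * _ / _.
have cE : alpha * moment2 rho / jrate alpha delta N = E * (1 - q).
  by rewrite /E /q; field; rewrite T0 L0.
elim: n x => [|n IH] x /=; first by rewrite mul1r subrK.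
rewrite (_ : iter n _ _ = fun y => (q ^+ n * emp_var y + (E - q ^+ n * E))%:E).
  rewrite jump_kernel_emp_var // cE -/q exprS; congr EFin; ring.
by apply/funext => y; rewrite IH; congr EFin; ring.
Qed.

Lemma cvg_series_expR (R : realType) (x : R) :
  (fun n => \sum_(0 <= i < n) x ^+ i / i`!%:R) @ \oo --> expR x.
Proof. exact: is_cvg_series_exp_coeff. Qed.

(** Poisson averaging turns q^n into exp(- l t) exp(q l t) = exp(- theta t), because l (1 - q) =
    theta; the constant part is preserved since the weights sum to 1. *)
Lemma semigroup_emp_var (R : realType) (rho : probability R R)
    (alpha delta : R) (k : nat) (ks : seq nat) (N : nat) (t : R) (x : 'I_N -> R) :
  (2 <= k)%N -> (k <= N)%N -> all (fun a => 2 <= a)%N ks -> sumn ks = k ->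
  0 < alpha -> 0 < delta -> 0 < moment2 rho ->
  semigroup rho alpha delta k ks t (fun y => (emp_var y)%:E) x =
  (expR (- (relax_rate R delta k ks N * t)) * emp_var x
   + alpha * moment2 rho / relax_rate R delta k ks N
     * (1 - expR (- (relax_rate R delta k ks N * t))))%:E.
Proof.
move=> k2 kN ks2 ksk a0 d0 m0.
have L0 := lt0r_neq0 (jrate_gt0 R alpha delta N a0 d0).
rewrite /semigroup; set th := relax_rate _ _ _ _ _; set E := _ / th.
set l := jrate _ _ _; pose q := 1 - th / l.
rewrite (_ : (fun n => _) = (fun n => (\sum_(0 <= i < n)
    (expR (- (l * t)) * (emp_var x - E) * ((q * (l * t)) ^+ i / i`!%:R)
     + expR (- (l * t)) * E * ((l * t) ^+ i / i`!%:R)))%:E)); last first.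
  apply/funext => n; rewrite -sumEFin; apply: eq_bigr => i _.
  rewrite iter_jump_kernel_emp_var // -EFinM; congr EFin.
  by rewrite -/l -/th -/q -/E [(q * _) ^+ i]exprMn; ring.
apply: cvg_lim => //; apply: cvg_EFin; first exact: nearW.
rewrite (_ : _ \o _ = (fun n =>
    expR (- (l * t)) * (emp_var x - E) * (\sum_(0 <= i < n) (q * (l * t)) ^+ i / i`!%:R)
    + expR (- (l * t)) * E * (\sum_(0 <= i < n) (l * t) ^+ i / i`!%:R))); last first.
  by apply/funext => n /=; rewrite big_split /= -!mulr_sumr.
rewrite (_ : _ + _ = expR (- (l * t)) * (emp_var x - E) * expR (q * (l * t))
    + expR (- (l * t)) * E * expR (l * t)); last first.
  have e1 : expR (- (l * t)) * expR (l * t) = 1 by rewrite -expRD addNr expR0.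
  have e2 : expR (- (l * t)) * expR (q * (l * t)) = expR (- (th * t)).
    by rewrite -expRD; congr expR; rewrite /q; field.
  by rewrite [_ * E * _]mulrAC e1 -e2; ring.
apply: cvgD; apply: cvgMr; exact: cvg_series_expR.
Qed.

Lemma emp_var_ge0 (R : realType) (N : nat) (x : 'I_N -> R) : 0 <= emp_var x.
Proof.
rewrite /emp_var divr_ge0 //; apply: sumr_ge0 => m _.
by apply: sumr_ge0 => n _; exact: sqr_ge0.
Qed.

Lemma measurable_emp_var (R : realType) (d : measure_display)
    (Omega : measurableType d) (N : nat) (Y : 'I_N -> Omega -> R) :
  (forall i, measurable_fun setT (Y i)) ->
  measurable_fun setT (fun w => emp_var (fun i => Y i w)).
Proof.
move=> mY; rewrite /emp_var; apply: measurable_funM => //.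
apply: measurable_sum => m.
rewrite [X in measurable_fun _ X](_ : _ = fun w =>
  \sum_(n < N) if (m < n)%N then (Y m w - Y n w) ^+ 2 else 0); last first.
  by apply/funext => w; rewrite big_mkcond.
apply: measurable_sum => n; case: (m < n)%N => //.
by apply: measurable_funX; exact: measurable_funB.
Qed.

(** For t >= 0 both terms of the pointwise formula are nonnegative, so the integral splits in the
    extended reals even if the initial mean is infinite. *)
Lemma RNE (R : realType) (rho : probability R R)
    (alpha delta : R) (k : nat) (ks : seq nat) (d : measure_display)
    (Omega : measurableType d) (P : probability Omega R)
    (X : forall N : nat, 'I_N -> Omega -> R) (N : nat) (t : R) :
  (2 <= k)%N -> (k <= N)%N -> all (fun a => 2 <= a)%N ks -> sumn ks = k ->
  0 < alpha -> 0 < delta -> 0 < moment2 rho ->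
  (forall i : 'I_N, measurable_fun setT (X N i)) -> 0 <= t ->
  (RN rho alpha delta k ks P X N t =
  (expR (- (relax_rate R delta k ks N * t)))%:E
    * \int[P]_w (emp_var (fun i => X N i w))%:E
   + (alpha * moment2 rho / relax_rate R delta k ks N
     * (1 - expR (- (relax_rate R delta k ks N * t))))%:E)%E.
Proof.
move=> k2 kN ks2 ksk a0 d0 m0 mX t0.
have T0 := relax_rate_gt0 R delta k ks N k2 (leq_trans k2 kN) ks2 ksk d0.
have mV := measurable_emp_var R d Omega N _ mX.
have mVE : measurable_fun setT (fun w => (emp_var (fun i => X N i w))%:E).
  exact/measurable_EFinP.
rewrite /RN; under eq_integral do rewrite semigroup_emp_var // EFinD EFinM.
set E := _ * (1 - _).
have E0 : 0 <= E.
  apply: mulr_ge0; first exact: divr_ge0 (mulr_ge0 (ltW a0) (ltW m0)) (ltW T0).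
  by rewrite subr_ge0 expR_le1 oppr_le0 mulr_ge0 // ltW.
rewrite ge0_integralD //=.
- rewrite integral_cst //= probability_setT mule1 ge0_integralZl_EFin ?expR_ge0 //.
  by move=> w _; rewrite lee_fin emp_var_ge0.
- by move=> w _; rewrite -EFinM lee_fin mulr_ge0 ?expR_ge0 ?emp_var_ge0.
- exact: measurable_funeM.
Qed.

(** * Asymptotics of the explicit mean *)

Lemma cvg_bounded_div (R : realType) (f g : nat -> R) (C : R) :
  (\forall n \near \oo, `|f n| <= C) -> g @ \oo --> +oo ->
  (fun n => f n / g n) @ \oo --> (0 : R).
Proof.
move=> fC gy.
have g0 : \forall n \near \oo, 0 < g n by exact: cvgry_gt.
have Cg : (fun n => C * (g n)^-1) @ \oo --> (0 : R).
  by rewrite -[X in _ --> X](mulr0 C); apply: cvgMr; apply/gtr0_cvgV0.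
have NCg : (fun n => - (C * (g n)^-1)) @ \oo --> (0 : R).
  by rewrite -[X in _ --> X]oppr0; exact: cvgN.
apply: (squeeze_cvgr _ NCg Cg); near=> n.
have gn : 0 < g n by near: n.
rewrite -ler_norml normrM [`|(g n)^-1|]gtr0_norm ?invr_gt0 //.
by rewrite ler_pM2r ?invr_gt0 //; near: n.
Unshelve. all: by end_near.
Qed.

(** The quotient lies between 1 / (1 + s) and 1; both bounds come from 1 + x <= exp x, taken at x =
    s and at x = - s. *)
Lemma cvg_one_sub_expRN_div (R : realType) (s : nat -> R) :
  (\forall n \near \oo, 0 < s n) -> s @ \oo --> (0 : R) ->
  (fun n => (1 - expR (- s n)) / s n) @ \oo --> (1 : R).
Proof.
move=> s0 sc.
have lc : (fun n => (1 + s n)^-1) @ \oo --> (1 : R).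
  rewrite -[X in _ --> X]invr1; apply: cvgV => //.
  by rewrite -[X in _ --> X]addr0; apply: cvgD => //; exact: cvg_cst.
apply: (squeeze_cvgr _ lc (@cvg_cst _ _ _ _ _)); near=> n.
have sn : 0 < s n by near: n.
have s1 : 0 < 1 + s n by rewrite addr_gt0.
apply/andP; split; last first.
  by rewrite ler_pdivrMr // mul1r lerBlDr addrC -lerBlDr expR_ge1Dx.
rewrite ler_pdivlMr //.
have e : expR (- s n) <= (1 + s n)^-1.
  by rewrite expRN lef_pV2 ?posrE ?expR_gt0 // expR_ge1Dx.
have -> : (1 + s n)^-1 * s n = 1 - (1 + s n)^-1 by field; rewrite lt0r_neq0.
by rewrite lerD2l lerN2.
Unshelve. all: by end_near.
Qed.

Lemma cvg_pairs_div_sqr (R : realType) :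
  (fun N => (N * (N - 1))%:R / N%:R ^+ 2 : R) @ \oo --> (1 : R).
Proof.
have c : (fun N => 1 - (N%:R : R)^-1) @ \oo --> (1 : R).
  rewrite -[X in _ --> X]subr0; apply: cvgB; first exact: cvg_cst.
  apply/gtr0_cvgV0; last exact: cvgr_idn.
  by exists 1%N => // n /= n1; rewrite ltr0n.
apply: cvg_trans c; apply: near_eq_cvg; near=> N.
have N1 : (1 <= N)%N by near: N; exact: nbhs_infty_ge.
have N0 : N%:R != 0 :> R by rewrite pnatr_eq0 -lt0n.
by rewrite natrM natrB //; field.
Unshelve. all: by end_near.
Qed.

Lemma cvg_sqr_div_pairs (R : realType) :
  (fun N => N%:R ^+ 2 / (N * (N - 1))%:R : R) @ \oo --> (1 : R).
Proof.
rewrite (_ : (fun N => _) = (fun N => ((N * (N - 1))%:R / N%:R ^+ 2)^-1)).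
  rewrite -[X in _ --> X]invr1; apply: cvgV; first exact: oner_neq0.
  exact: cvg_pairs_div_sqr.
by apply/funext => N; rewrite invf_div.
Qed.

Lemma cvg_sqr_natr (R : realType) : (fun N => N%:R ^+ 2 : R) @ \oo --> +oo.
Proof. exact: (cvg_comp _ _ cvgr_idn cvgr_expr2). Qed.

(* R_N(t N) with D = delta kappa, A = alpha b_2 and r N = R_N(0). *)
Definition mean_var (R : realType) (D A : R) (r t : nat -> R) (N : nat) : R :=
  expR (- (D / (N * (N - 1))%:R * t N)) * r N
  + A / (D / (N * (N - 1))%:R) * (1 - expR (- (D / (N * (N - 1))%:R * t N))).

(** Isolates t / N^2, the quantity that distinguishes the regimes; the remaining factor tends to
    D. *)
Lemma near_relaxE (R : realType) (D : R) (t : nat -> R) :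
  \forall N \near \oo, D / (N * (N - 1))%:R * t N =
    D * (N%:R ^+ 2 / (N * (N - 1))%:R) * (t N / N%:R ^+ 2).
Proof.
near=> N; have N1 : (2 <= N)%N by near: N; exact: nbhs_infty_ge.
have N0 : N%:R != 0 :> R by rewrite pnatr_eq0; lia.
have N2 : (N - 1)%:R != 0 :> R by rewrite pnatr_eq0; lia.
by field; rewrite N0 N2.
Unshelve. all: by end_near.
Qed.

Lemma cvg_relax (R : realType) (D c : R) (t : nat -> R) :
  (fun N => t N / N%:R ^+ 2) @ \oo --> c ->
  (fun N => D / (N * (N - 1))%:R * t N) @ \oo --> D * c.
Proof.
move=> tc.
have h : (fun N => D * (N%:R ^+ 2 / (N * (N - 1))%:R) * (t N / N%:R ^+ 2)) @ \oo --> D * c.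
  rewrite -[X in X * c]mulr1; apply: cvgM => //.
  by apply: cvgMr; exact: cvg_sqr_div_pairs.
by apply: cvg_trans h; apply: near_eq_cvg; by apply: filterS (near_relaxE R D t) => N ->.
Qed.

Lemma cvgy_scale (R : realType) (a : R) (f : nat -> R) : 0 < a ->
  f @ \oo --> +oo -> (fun n => a * f n) @ \oo --> +oo.
Proof.
move=> a0 /cvgryPge fy; apply/cvgryPge => b.
by apply: filterS (fy (b / a)) => n; rewrite ler_pdivrMr // mulrC.
Qed.

Lemma cvgy_relax (R : realType) (D : R) (t : nat -> R) : 0 < D ->
  (fun N => t N / N%:R ^+ 2) @ \oo --> +oo ->
  (fun N => D / (N * (N - 1))%:R * t N) @ \oo --> +oo.
Proof.
move=> D0 ty.
have h : (fun N => D * (t N / N%:R ^+ 2)) @ \oo --> +oo by exact: cvgy_scale.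
apply/cvgryPge => a; near=> N.
have N2 : (2 <= N)%N by near: N; exact: nbhs_infty_ge.
rewrite (near (near_relaxE R D t) N) // mulrAC.
(* The correction N^2 / (N (N - 1)) is at least 1, so dropping it leaves a lower bound that still
   diverges. *)
apply: (@le_trans _ _ (D * (t N / N%:R ^+ 2))).
  by near: N; exact: cvgry_ge.
rewrite ler_peMr //; first by near: N; exact: cvgry_ge.
rewrite ler_pdivlMr ?mul1r ?ltr0n; last by lia.
by rewrite -natrX ler_nat; nia.
Unshelve. all: by end_near.
Qed.

(** The exponential factor is at most 1 once t >= 0. The initial variance thus stays bounded, hence
    is negligible against the diverging scale of every regime. *)
Lemma near_bounded_relax (R : realType) (D C : R) (r t : nat -> R) : 0 < D ->
  (\forall N \near \oo, `|r N| <= C) -> t @ \oo --> +oo ->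
  \forall N \near \oo, `|expR (- (D / (N * (N - 1))%:R * t N)) * r N| <= C.
Proof.
move=> D0 rC ty; near=> N.
have t0 : 0 <= t N by near: N; exact: cvgry_ge.
rewrite normrM ger0_norm ?expR_ge0 //.
apply: (@le_trans _ _ `|r N|); last by near: N.
by rewrite ler_piMl // expR_le1 oppr_le0 mulr_ge0 // divr_ge0 // ltW.
Unshelve. all: by end_near.
Qed.

(** Divided by A t, the stationary term becomes (1 - exp(- s)) / s with s = theta t tending to 0. *)
Lemma mean_var_short (R : realType) (D A C : R) (r t : nat -> R) :
  0 < D -> 0 < A -> (\forall N \near \oo, `|r N| <= C) -> t @ \oo --> +oo ->
  (fun N => t N / N%:R ^+ 2) @ \oo --> 0 ->
  (fun N => mean_var R D A r t N / (A * t N)) @ \oo --> (1 : R).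
Proof.
move=> D0 A0 rC ty tN.
pose s N := D / (N * (N - 1))%:R * t N.
have s0 : \forall N \near \oo, 0 < s N.
  near=> N; have N2 : (2 <= N)%N by near: N; exact: nbhs_infty_ge.
  rewrite mulr_gt0 ?divr_gt0 ?ltr0n //; first by lia.
  by near: N; exact: cvgry_gt.
have sc : s @ \oo --> 0 by rewrite -(mulr0 D); exact: cvg_relax.
have h1 := cvg_bounded_div R _ _ _ (near_bounded_relax R D C r t D0 rC ty)
   (cvgy_scale R _ _ A0 ty).
have h : (fun N => expR (- s N) * r N / (A * t N) + (1 - expR (- s N)) / s N)
    @ \oo --> (1 : R).
  by rewrite -[X in _ --> X]add0r; exact: cvgD h1 (cvg_one_sub_expRN_div R s s0 sc).
apply: cvg_trans h; apply: near_eq_cvg; near=> N.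
have N2 : (2 <= N)%N by near: N; exact: nbhs_infty_ge.
have N0 : N%:R != 0 :> R by rewrite pnatr_eq0; lia.
have N1 : (N - 1)%:R != 0 :> R by rewrite pnatr_eq0; lia.
have t0 : t N != 0 by apply: lt0r_neq0; near: N; exact: cvgry_gt.
rewrite /mean_var /s; move: (expR _) => e; field.
by rewrite t0 N0 N1 !lt0r_neq0.
Unshelve. all: by end_near.
Qed.

(** Regimes (ii) and (iii) together: [l] is 1 - exp(- delta kappa c) in the former and 1 in the
    latter. *)
Lemma mean_var_long (R : realType) (D A C l : R) (r t : nat -> R) :
  0 < D -> 0 < A -> 0 < l -> (\forall N \near \oo, `|r N| <= C) -> t @ \oo --> +oo ->
  (fun N => 1 - expR (- (D / (N * (N - 1))%:R * t N))) @ \oo --> l ->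
  (fun N => mean_var R D A r t N / (A / D * l * N%:R ^+ 2)) @ \oo --> (1 : R).
Proof.
move=> D0 A0 l0 rC ty el.
have B0 : 0 < A / D * l by exact: mulr_gt0 (divr_gt0 A0 D0) l0.
have h1 := cvg_bounded_div R _ _ _ (near_bounded_relax R D C r t D0 rC ty)
   (cvgy_scale R _ _ B0 (cvg_sqr_natr R)).
pose e N := expR (- (D / (N * (N - 1))%:R * t N)).
have h2 : (fun N => (N * (N - 1))%:R / N%:R ^+ 2 * (l^-1 * (1 - e N))) @ \oo --> (1 : R).
  have l1 : 1 * (l^-1 * l) = 1 by rewrite mulVf ?mulr1 ?lt0r_neq0.
  rewrite -[X in _ --> X]l1.
  by apply: cvgM; [exact: cvg_pairs_div_sqr|exact: cvgMr].
have h : (fun N => e N * r N / (A / D * l * N%:R ^+ 2)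
    + (N * (N - 1))%:R / N%:R ^+ 2 * (l^-1 * (1 - e N))) @ \oo --> (1 : R).
  by rewrite -[X in _ --> X]add0r; exact: cvgD h1 h2.
apply: cvg_trans h; apply: near_eq_cvg; near=> N.
have N2 : (2 <= N)%N by near: N; exact: nbhs_infty_ge.
have N0 : N%:R != 0 :> R by rewrite pnatr_eq0; lia.
have N1 : (N - 1)%:R != 0 :> R by rewrite pnatr_eq0; lia.
rewrite /mean_var -/(e N); move: (e N) => f; field.
by rewrite N0 N1 !lt0r_neq0.
Unshelve. all: by end_near.
Qed.

(** * The three time regimes *)

Theorem theorem2 (R : realType) (k : nat) (ks : seq nat)
  (alpha delta : R) (rho : probability R R)
  (d : measure_display) (Omega : measurableType d) (P : probability Omega R)
  (X : forall N : nat, 'I_N -> Omega -> R) (t : nat -> R) :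
  (2 <= k)%N -> all (fun a => 2 <= a)%N ks -> sumn ks = k ->
  0 < alpha -> 0 < delta ->
  (exists M : R, rho [set z : R | M < `|z|] = 0%E) ->
  0 < moment2 rho ->
  (forall N (i : 'I_N), measurable_fun setT (X N i)) ->
  (exists C : R, forall N, (k <= N)%N ->
     (`| RN rho alpha delta k ks P X N 0 | <= C%:E)%E) ->
  t @ \oo --> +oo ->
  let kappa : R := ((sumn (map (fun a => (a ^ 2)%N) ks))%:R - k%:R) in
  let RNt := fun N => RN rho alpha delta k ks P X N (t N) in
  (* (i) *)
  ((fun N => t N / (N%:R ^+ 2)) @ \oo --> 0 ->
     (\forall N \near \oo, RNt N \is a fin_num) /\
     (fun N => fine (RNt N) / (alpha * moment2 rho * t N)) @ \oo --> (1:R))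
  /\
  (* (ii) *)
  (forall c : R, 0 < c -> (forall N, t N = c * N%:R ^+ 2) ->
     (\forall N \near \oo, RNt N \is a fin_num) /\
     (fun N => fine (RNt N) /
        (alpha * moment2 rho / (delta * kappa)
         * (1 - expR (- (delta * kappa * c))) * N%:R ^+ 2)) @ \oo --> (1:R))
  /\
  (* (iii) *)
  ((fun N => t N / (N%:R ^+ 2)) @ \oo --> +oo ->
     (\forall N \near \oo, RNt N \is a fin_num) /\
     (fun N => fine (RNt N) /
        (alpha * moment2 rho / (delta * kappa) * N%:R ^+ 2)) @ \oo --> (1:R)).
Proof.
move=> k2 ks2 ksk a0 d0 _ m0 mX [C bC] ty kappa RNt.
pose V N : \bar R := (\int[P]_w (emp_var (fun i => X N i w))%:E)%E.
(* At time 0 the explicit formula reduces to the initial mean, so the assumed bound on R_N(0) makes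
   [V N] finite and bounds [r]. *)
have V0 N : (k <= N)%N -> RN rho alpha delta k ks P X N 0 = V N.
  move=> kN; rewrite RNE //.
  by rewrite mulr0 oppr0 expR0 subrr mulr0 mul1e adde0.
pose r N := fine (V N).
have Vr N : (k <= N)%N -> V N = (r N)%:E.
  move=> kN; rewrite fineK // fin_num_abs -V0 //.
  by apply: le_lt_trans (bC N kN) _; exact: ltry.
have rC : \forall N \near \oo, `|r N| <= C.
  near=> N; have kN : (k <= N)%N by near: N; exact: nbhs_infty_ge.
  by have := bC N kN; rewrite V0 // Vr // lee_fin.
have A0 : 0 < alpha * moment2 rho by exact: mulr_gt0.
have D0 : 0 < delta * kappa.
  rewrite mulr_gt0 // subr_gt0 ltr_nat -{1}ksk sumn_lt_sumn_sqr // ksk; lia.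
(* Only large N are covered: the formula needs k <= N, and t N >= 0 comes from the divergence of
   [t]. *)
have RNtE : \forall N \near \oo, RNt N =
    (mean_var R (delta * kappa) (alpha * moment2 rho) r t N)%:E.
  near=> N; have kN : (k <= N)%N by near: N; exact: nbhs_infty_ge.
  have t0 : 0 <= t N by near: N; exact: cvgry_ge.
  by rewrite /RNt RNE // -/(V N) Vr // -EFinM -EFinD.
have fin : \forall N \near \oo, RNt N \is a fin_num.
  by apply: filterS RNtE => N ->.
have equiv (g : nat -> R) :
    (fun N => mean_var R (delta * kappa) (alpha * moment2 rho) r t N / g N) @ \oo --> (1 : R) ->
    (fun N => fine (RNt N) / g N) @ \oo --> (1 : R).
  move=> h; apply: cvg_trans h; apply: near_eq_cvg.
  by apply: filterS RNtE => N ->.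
split=> [tN|]; last split=> [c c0 tE|tN]; split=> //; apply: equiv.
- exact: mean_var_short rC ty tN.
- have e1 : expR (- (delta * kappa * c)) < 1.
    by rewrite expR_lt1 oppr_lt0 mulr_gt0.
  apply: mean_var_long rC ty _ => //; first by rewrite subr_gt0.
  apply: cvgB; first exact: cvg_cst.
  have sc : (fun N => - (delta * kappa / (N * (N - 1))%:R * t N)) @ \oo
      --> - (delta * kappa * c); last exact: cvg_comp sc (@continuous_expR R _).
  apply: cvgN; apply: cvg_relax.
  (* The quotient is c only for nonzero N; at N = 0 division by zero returns 0. *)
  apply: (cvg_trans _ (@cvg_cst R c _ \oo _)); apply: near_eq_cvg; near=> N.
  have N0 : N%:R != 0 :> R.
    by rewrite pnatr_eq0 -lt0n; near: N; exact: nbhs_infty_gt.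
  by rewrite tE; field.
(* The inserted factor 1 is the limit [l] of 1 - exp(- theta t) when theta t diverges. *)
- under eq_fun do rewrite -[_ / (delta * kappa)]mulr1.
  apply: mean_var_long rC ty _ => //.
  rewrite -[X in _ --> X]subr0; apply: cvgB; first exact: cvg_cst.
  exact: cvg_comp (cvgy_relax R _ t D0 tN) (@cvgr_expR R).
Unshelve. all: by end_near.
Qed.
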